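(* Let $(G,\rho)$ be a parametrized influence diagram with $G=(V^{\mathrm{s}},V^{\mathrm{a}},E)$, $\rho=(\mathcal{X}_V,\mathfrak{p},r)$, let $\mathcal{G}$ be a rooted junction tree on $G$ in which the offspring of $C_v$ is $\{v\}$ for every $v\in V$, and let $b=(b_{\check C_v})_{v\in V^{\mathrm{a}}}$ be an admissible bound, i.e. $\mathbb{P}_{\delta'}(X_{\check C_v}=x_{\check C_v})\le b_{\check C_v}(x_{\check C_v})$ for all $\delta'\in\Delta$, $v\in V^{\mathrm{a}}$, $x_{\check C_v}\in\mathcal{X}_{\check C_v}$. Consider the mixed integer linear program $$\text{(MILP)}\quad\max_{\mu,\delta}\ \sum_{v\in V^{\mathrm{r}}}\langle r_v,\mu_v\rangle\quad\text{s.t.}\quad\mu\in\mathcal{P}^{\perp},\quad\delta\in\Delta^{\mathrm{d}},\quad(\mu,\delta)\in\mathcal{Q}^b.$$ Then any feasible solution $(\mu,\delta)$ of (MILP) is such that $\mu$ is the vector of moments of the distribution $\mathbb{P}_\delta$. Hence, $(\mu,\delta)$ is an optimal solution of (MILP) if and only if $\delta$ is an optimal solution of the maximum expected utility problem $\max_{\delta\in\Delta}\mathbb{E}_\delta\big[\sum_{v\in V^{\mathrm{r}}}r_v(X_v)\big]$ (for feasible solutions $(\mu,\delta)$ of (MILP)).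
   Context: Influence diagrams. An influence diagram (ID) $G=(V^{\mathrm{s}},V^{\mathrm{a}},E)$ is a finite acyclic digraph with vertex set $V=V^{\mathrm{s}}\sqcup V^{\mathrm{a}}$, where $V^{\mathrm{a}}$ is the set of decision vertices and $V^{\mathrm{s}}$ is the disjoint union of the chance vertices and the utility vertices $V^{\mathrm{r}}$; utility vertices have no children. $\mathrm{pa}(v)$ denotes the parents of $v$, $\mathrm{fa}(v)=\{v\}\cup\mathrm{pa}(v)$. A parametrization $\rho=(\mathcal{X}_V,\mathfrak{p},r)$ consists of finite nonempty sets $\mathcal{X}_v$ ($v\in V$), conditional distributions $\mathfrak{p}=\{p_{v|\mathrm{pa}(v)}\}_{v\in V^{\mathrm{s}}}$ on $\mathcal{X}_v$ given $\mathcal{X}_{\mathrm{pa}(v)}$, and rewards $r_v:\mathcal{X}_v\to\mathbb{R}$, $v\in V^{\mathrm{r}}$; $\mathcal{X}_C=\prod_{v\in C}\mathcal{X}_v$. A policy is $\delta=(\delta_{v|\mathrm{pa}(v)})_{v\in V^{\mathrm{a}}}\in\Delta=\prod_{v\in V^{\mathrm{a}}}\Delta_v$, where $\Delta_v$ is the set of conditional distributions on $\mathcal{X}_v$ given $\mathcal{X}_{\mathrm{pa}(v)}$; $\Delta^{\mathrm{d}}\subset\Delta$ is the set of deterministic policies (all values $\delta_{v|\mathrm{pa}(v)}(x_v|x_{\mathrm{pa}(v)})$ in $\{0,1\}$). $\mathbb{P}_\delta(X_V=x_V)=\prod_{v\in V^{\mathrm{s}}}p_{v|\mathrm{pa}(v)}(x_v|x_{\mathrm{pa}(v)})\prod_{v\in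 V^{\mathrm{a}}}\delta_{v|\mathrm{pa}(v)}(x_v|x_{\mathrm{pa}(v)})$, with expectation $\mathbb{E}_\delta$. Rooted junction trees. A junction tree of $G$ is an undirected tree whose nodes are subsets of $V$, such that each $\mathrm{fa}(v)$ is contained in some node, and for any two nodes $C_1,C_2$ every node on the path between them contains $C_1\cap C_2$. A rooted junction tree (RJT) $\mathcal{G}$ on $G$ is a rooted tree (arcs directed away from the root) with nodes in $2^V$ whose underlying undirected graph is a junction tree of $G$ and such that $\mathrm{fa}(v)\subseteq C_v$ for all $v$, where $C_v$ (root clique of $v$) is the root of the subtree induced by the nodes containing $v$. The offspring of a node $C$ is $\{v:C_v=C\}$. RJTs in which the offspring of $C_v$ is $\{v\}$ for all $v$ are understood to have exactly the nodes $(C_v)_{v\in V}$. Put $\check C_v=C_v\setminus\{v\}$. Polytopes (equalities and inequalities between functions are pointwise). $\mathcal{L}_{\mathcal{G}}$ is the set of $\mu=(\mu_{C_v},\mu_{\check C_v})_{v\in V}$ such that each $\mu_{C_v}$ is a probability distribution on $\mathcal{X}_{C_v}$, adjacent nodes $C,C'$ of $\mathcal{G}$ satisfy $\sum_{x_{C\setminus C'}}\mu_C=\sum_{x_{C'\setminus C}}\mu_{C'}$, and $\mu_{\check C_v}=\sum_{x_v}\mu_{C_v}$. $\mu$ is the vector of moments of $\mathbb{P}_\delta$ if $\mu_{C_v}(x_{C_v})=\mathbb{P}_\delta(X_{C_v}=x_{C_v})$ for all $v,x_{C_v}$. For $v\in V^{\mathrm{r}}$, $\mu_v$ is the marginal of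 $\mu_{C_v}$ on $\mathcal{X}_v$ and $\langle r_v,\mu_v\rangle=\sum_{x_v}r_v(x_v)\mu_v(x_v)$. $\overline{\mathcal{P}}=\{\mu\in\mathcal{L}_{\mathcal{G}}:\mu_{C_v}=\mu_{\check C_v}\,p_{v|\mathrm{pa}(v)}\ \forall v\in V^{\mathrm{s}}\}$. For $C\subseteq V$, $C^{\perp}$ is the largest subset $D$ of $C$ such that, for any parametrization of $G$, the conditional distribution $\mathbb{P}_\delta(X_D|X_{C\setminus D})$ does not depend on the policy $\delta$ (at values of $X_{C\setminus D}$ of positive probability); it exists and equals $\{v\in C: v\perp\vartheta_{V^{\mathrm{a}}}\mid C\setminus\{v\}\}$, with $\perp$ d-separation in the augmented graph $G^\dagger$ obtained from $G$ by adding for each $w\in V^{\mathrm{a}}$ a vertex $\vartheta_w$ and the arc $(\vartheta_w,w)$, and $\vartheta_{V^{\mathrm{a}}}=\{\vartheta_w\}_{w\in V^{\mathrm{a}}}$. $C^{\not\perp}=C\setminus C^{\perp}$, and $p_{C^{\perp}|C^{\not\perp}}$ is the common conditional distribution (given the parametrization): $p_{C^\perp|C^{\not\perp}}(x_{C^\perp}|x_{C^{\not\perp}})=\mathbb{P}_\delta(X_{C^\perp}=x_{C^\perp}|X_{C^{\not\perp}}=x_{C^{\not\perp}})$ for any $\delta$ with $\mathbb{P}_\delta(X_{C^{\not\perp}}=x_{C^{\not\perp}})>0$, and (by convention) uniform if there is no such $\delta$. $\mathcal{P}^{\perp}=\{\mu\in\overline{\mathcal{P}}:\mu_{C_v}=p_{C_v^{\perp}|C_v^{\not\perp}}\sum_{x_{C_v^{\perp}}}\mu_{C_v}\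 \forall v\in V^{\mathrm{a}}\}$. $\mathcal{Q}^b$ is the set of $(\mu,\delta)\in\mathcal{L}_{\mathcal{G}}\times\Delta$ such that for all $v\in V^{\mathrm{a}}$: $\mu_{C_v}\ge\mu_{\check C_v}+(\delta_{v|\mathrm{pa}(v)}-1)\,b_{\check C_v}$, $\mu_{C_v}\le\delta_{v|\mathrm{pa}(v)}\,b_{\check C_v}$, and $\mu_{C_v}\le\mu_{\check C_v}$. *)

(* Defs.v *)
From mathcomp Require Import all_boot all_order all_algebra.
From mathcomp Require Import boolp reals.

Set Implicit Arguments.
Unset Strict Implicit.
Unset Printing Implicit Defensive.

Import Order.TTheory GRing.Theory Num.Theory.
Local Open Scope ring_scope.

(* A family indexed by a subset of the vertices (decision rules, conditional
   distributions, rewards, bounds) is a function on all vertices whose values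
   outside that subset are unconstrained and never used. *)

Record influence_diagram (V : finType) := InfluenceDiagram {
  arc : rel V;
  decisions : {set V};
  utilities : {set V};
  arc_acyclic : forall u v, arc u v -> ~~ connect arc v u;
  utilities_decisions : [disjoint utilities & decisions];
  utilities_childless : forall u v, u \in utilities -> ~~ arc u v
}.

(* V^s, made of the chance and of the utility vertices. *)
Definition nondecisions (V : finType) (G : influence_diagram V) : {set V} :=
  ~: decisions G.

Definition parents (V : finType) (G : influence_diagram V) (v : V) : {set V} :=
  [set u | arc G u v].

Definition family (V : finType) (G : influence_diagram V) (v : V) : {set V} :=
  v |: parents G v.

(* asg X C is the product of the X v for v in C, and fasg X that of all X v. *)
Notation asg X C := {dffun forall v : {v | v \in C}, X (val v)}.
Notation fasg X := {dffun forall v, X v}.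

Section Assignments.
Variables (R : realType) (V : finType) (X : V -> finType).

Definition res (C : {set V}) (x : fasg X) : asg X C := [ffun v => x (val v)].

(* \sum_(x_B) f, for f a function on asg X C. It is a function of x_(C \ B);
   here and below such a function takes a full assignment x and depends only on
   the relevant coordinates. All X v are nonempty, so every partial assignment
   is the restriction of a full one. *)
Definition sum_out (C : {set V}) (f : asg X C -> R) (B : {set V})
    (x : fasg X) : R :=
  \sum_(z : asg X C | [forall u, (val u \notin B) ==> (z u == x (val u))]) f z.

End Assignments.

Definition is_distr (R : realType) (A : finType) (f : A -> R) : Prop :=
  (forall a, 0 <= f a) /\ \sum_a f a = 1.

Record parametrization (R : realType) (V : finType) (G : influence_diagram V) :=
  Parametrization {
  dom : V -> finType;
  dom_nonempty : forall v, (0 < #|dom v|)%N;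
  kern : forall v, asg dom (parents G v) -> dom v -> R;
  kern_distr : forall v, v \in nondecisions G ->
    forall y, is_distr (kern (v := v) y);
  reward : forall v, dom v -> R
}.

Arguments dom {R V G} _ _.
Arguments kern {R V G} _ {v} _ _.
Arguments reward {R V G} _ {v} _.

Section Policies.
Variables (R : realType) (V : finType) (G : influence_diagram V).
Variable rho : parametrization R G.
Let X := dom rho.

Definition rules := forall v, asg X (parents G v) -> X v -> R.

Definition is_policy (delta : rules) : Prop :=
  forall v, v \in decisions G -> forall y, is_distr (delta v y).

Definition is_deterministic_policy (delta : rules) : Prop :=
  is_policy delta /\
  (forall v, v \in decisions G ->
     forall y a, delta v y a = 0 \/ delta v y a = 1).

Definition joint (delta : rules) (x : fasg X) : R :=
  (\prod_(v in nondecisions G) kern rho (res (parents G v) x) (x v)) *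
  (\prod_(v in decisions G) delta v (res (parents G v) x) (x v)).

(* P_delta(X_C = z) *)
Definition Pr (delta : rules) (C : {set V}) (z : asg X C) : R :=
  \sum_(x : fasg X | res C x == z) joint delta x.

(* P_delta(X_D = x_D | X_B = x_B), meaningful when P_delta(X_B = x_B) > 0 *)
Definition cPr (delta : rules) (D B : {set V}) (x : fasg X) : R :=
  Pr delta (res (D :|: B) x) / Pr delta (res B x).

Definition expected_utility (delta : rules) : R :=
  \sum_(x : fasg X) joint delta x * \sum_(v in utilities G) reward rho (x v).

Definition MEU_optimal (delta : rules) : Prop :=
  is_policy delta /\
  (forall delta', is_policy delta' ->
     expected_utility delta' <= expected_utility delta).

End Policies.

Section Perp.
Variables (R : realType) (V : finType) (G : influence_diagram V).

Definition policy_independent (C D : {set V}) : Prop :=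
  forall (rho : parametrization R G) (delta delta' : rules rho),
    is_policy delta -> is_policy delta' ->
  forall x : fasg (dom rho),
    0 < Pr delta (res (C :\: D) x) -> 0 < Pr delta' (res (C :\: D) x) ->
    cPr delta D (C :\: D) x = cPr delta' D (C :\: D) x.

Definition is_perp (C D : {set V}) : Prop :=
  [/\ D \subset C, policy_independent C D &
      forall D' : {set V},
        D' \subset C -> policy_independent C D' -> D' \subset D].

(* C^perp, the largest policy-independent subset of C for inclusion. It always
   exists, so that the default value set0 plays no role. *)
Definition perp (C : {set V}) : {set V} :=
  odflt set0 [pick D | `[< is_perp C D >]].

End Perp.

(* p_(C^perp | C^notperp)(x): the conditional probability under any policy
   charging x_(C^notperp) (the choice is immaterial by policy independence),
   and uniform on X_(C^perp) when there is no such policy. *)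
Definition perp_kern (R : realType) (V : finType) (G : influence_diagram V)
    (rho : parametrization R G) (C : {set V}) (x : fasg (dom rho)) : R :=
  let D := perp R G C in
  match pselect (exists delta : rules rho,
                   is_policy delta /\ 0 < Pr delta (res (C :\: D) x)) with
  | left ex => cPr (projT1 (cid ex)) D (C :\: D) x
  | right _ => (\prod_(v in D) #|dom rho v|%:R)^-1
  end.

Section Trees.
Variables (T : finType) (N : {set T}).

Definition is_tree (e : rel T) : Prop :=
  [/\ N != set0, irreflexive e, symmetric e,
      forall a b, e a b -> (a \in N) && (b \in N) &
      forall a b, a \in N -> b \in N ->
        exists! p, [/\ path e a p, uniq (a :: p) & last a p = b]].

(* Uniqueness is among directed walks, so there are no directed cycles. *)
Definition is_rooted_tree (t : rel T) (root : T) : Prop :=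
  [/\ root \in N, forall a b, t a b -> (a \in N) && (b \in N) &
      forall a, a \in N -> exists! p, path t root p /\ last root p = a].

End Trees.

Section JunctionTrees.
Variables (V : finType) (G : influence_diagram V).

Definition is_junction_tree (N : {set {set V}}) (e : rel {set V}) : Prop :=
  [/\ is_tree N e,
      forall v, exists2 C, C \in N & family G v \subset C &
      forall C1 C2 p, C1 \in N -> C2 \in N ->
        path e C1 p -> uniq (C1 :: p) -> last C1 p = C2 ->
        forall D, D \in C1 :: p -> C1 :&: C2 \subset D].

(* C is the root of the subtree induced by the nodes containing v. *)
Definition is_root_clique (N : {set {set V}}) (t : rel {set V}) (v : V)
    (C : {set V}) : Prop :=
  [/\ C \in N, v \in C &
      forall D, D \in N -> v \in D ->
        connect [rel A B : {set V} | [&& v \in A, v \in B & t A B]] C D].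

(* The map clique is determined by the tree. *)
Record rooted_junction_tree := RootedJunctionTree {
  nodes : {set {set V}};
  tarc : rel {set V};
  troot : {set V};
  clique : V -> {set V};
  rjt_rooted : is_rooted_tree nodes tarc troot;
  rjt_junction : is_junction_tree nodes [rel C D | tarc C D || tarc D C];
  rjt_clique : forall v, is_root_clique nodes tarc v (clique v);
  rjt_family : forall v, family G v \subset clique v
}.

Definition offspring (T : rooted_junction_tree) (C : {set V}) : {set V} :=
  [set v | clique T v == C].

(* The second clause rules out additional nodes without offspring. *)
Definition singleton_offspring (T : rooted_junction_tree) : Prop :=
  (forall v, offspring T (clique T v) = [set v]) /\
  nodes T = [set clique T v | v : V].

(* C_v minus v *)
Definition cliquem (T : rooted_junction_tree) (v : V) : {set V} :=
  clique T v :\ v.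

Lemma mem_clique (T : rooted_junction_tree) (v : V) : v \in clique T v.
Proof. by case: (rjt_clique T v). Qed.

End JunctionTrees.

Section Polytopes.
Variables (R : realType) (V : finType) (G : influence_diagram V).
Variables (rho : parametrization R G) (T : rooted_junction_tree G).
Let X := dom rho.

Record mvector := MVector {
  muC : forall v, asg X (clique T v) -> R;
  muc : forall v, asg X (cliquem T v) -> R
}.

Definition bounds := forall v, asg X (cliquem T v) -> R.

Definition in_L (mu : mvector) : Prop :=
  [/\ forall v, is_distr (muC mu (v := v)),
      forall u v, tarc T (clique T u) (clique T v) ||
                  tarc T (clique T v) (clique T u) ->
        forall x, sum_out (muC mu (v := u)) (clique T u :\: clique T v) x =
                  sum_out (muC mu (v := v)) (clique T v :\: clique T u) x &
      forall v x, muc mu (res (cliquem T v) x) =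
                  sum_out (muC mu (v := v)) [set v] x].

Definition in_Pbar (mu : mvector) : Prop :=
  in_L mu /\
  (forall v, v \in nondecisions G -> forall x,
     muC mu (res (clique T v) x) =
     muc mu (res (cliquem T v) x) * kern rho (res (parents G v) x) (x v)).

Definition in_Pperp (mu : mvector) : Prop :=
  in_Pbar mu /\
  (forall v, v \in decisions G -> forall x,
     muC mu (res (clique T v) x) =
     perp_kern (clique T v) x *
     sum_out (muC mu (v := v)) (perp R G (clique T v)) x).

Definition in_Q (b : bounds) (mu : mvector) (delta : rules rho) : Prop :=
  [/\ in_L mu, is_policy delta &
      forall v, v \in decisions G -> forall x,
        let m := muC mu (res (clique T v) x) in
        let mc := muc mu (res (cliquem T v) x) in
        let bx := b v (res (cliquem T v) x) in
        let d := delta v (res (parents G v) x) (x v) in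
        [/\ mc + (d - 1) * bx <= m, m <= d * bx & m <= mc]].

Definition admissible_bound (b : bounds) : Prop :=
  forall delta : rules rho, is_policy delta ->
  forall v, v \in decisions G ->
  forall z : asg X (cliquem T v), Pr delta z <= b v z.

Definition is_moments_of (mu : mvector) (delta : rules rho) : Prop :=
  forall v (z : asg X (clique T v)), muC mu z = Pr delta z.

(* mu_v *)
Definition mu_at (mu : mvector) (v : V) (a : X v) : R :=
  \sum_(z : asg X (clique T v) | z (exist _ v (mem_clique T v)) == a) muC mu z.

Definition MILP_objective (mu : mvector) : R :=
  \sum_(v in utilities G) \sum_(a : X v) reward rho a * mu_at mu a.

Definition MILP_feasible (b : bounds) (mu : mvector) (delta : rules rho) :
    Prop :=
  [/\ in_Pperp mu, is_deterministic_policy delta & in_Q b mu delta].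

Definition MILP_optimal (b : bounds) (mu : mvector) (delta : rules rho) :
    Prop :=
  MILP_feasible b mu delta /\
  (forall mu' delta', MILP_feasible b mu' delta' ->
     MILP_objective mu' <= MILP_objective mu).

End Polytopes.

(* Main.v *)
Require Import Defs.
From mathcomp Require Import all_boot all_order all_algebra.
From mathcomp Require Import boolp reals.

(** For a deterministic policy the McCormick constraints Q^b say that
    mu_(C_v) = mu_(C_v minus v) * delta_v at decision vertices, so mu and the
    moments of P_delta obey the same recursion along the junction tree: C_v
    minus v lies in the parent clique and contains no descendant of v, whence
    P_delta(C_v) = P_delta(C_v minus v) * (kernel of v). Conversely the moments
    of a deterministic policy are feasible (for the constraints P^perp only the
    policy independence of C^perp matters, not its d-separation description),
    and deterministic policies suffice, because the expected utility is affine
    in each distribution delta_v(. | y). *)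

Set Implicit Arguments.
Unset Strict Implicit.
Unset Printing Implicit Defensive.

(* MathComp has its own arc (path) and family (finfun). *)
Import Defs.
Import Order.TTheory GRing.Theory Num.Theory.
Local Open Scope ring_scope.

(** * Overwriting and restricting assignments *)

Section Assignments.
Variables (V : finType) (X : V -> finType).
Implicit Types (x y : fasg X) (B C D : {set V}).

Definition upd x v (a : X v) : fasg X := [ffun w => dfwith x a w].

Lemma upd_in x v (a : X v) : upd x a v = a.
Proof. by rewrite ffunE dfwith_in. Qed.

Lemma upd_out x v (a : X v) w : v != w -> upd x a w = x w.
Proof. by move=> vw; rewrite ffunE dfwith_out. Qed.

Lemma updK x v (a : X v) : upd (upd x a) (x v) = x.
Proof.
apply/ffunP => w; have [<-|vw] := eqVneq v w; first by rewrite upd_in.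
by rewrite !upd_out.
Qed.

Lemma resP C x y :
  reflect {in C, forall u, x u = y u} (res C x == res C y).
Proof.
apply: (iffP eqP) => [exy u uC|exy].
  by have /ffunP/(_ (exist _ u uC)) := exy; rewrite !ffunE.
by apply/ffunP => u; rewrite !ffunE exy // (valP u).
Qed.

Lemma eq_resS C D x y : C \subset D -> res D x == res D y -> res C x == res C y.
Proof. by move=> /subsetP sCD /resP e; apply/resP => u /sCD /e. Qed.

Lemma res_surj C (x0 : fasg X) (z : asg X C) : exists x, res C x = z.
Proof.
exists [ffun v => if boolP (v \in C) is AltTrue vC then z (exist _ v vC)
                  else x0 v].
apply/ffunP => -[u uC]; rewrite !ffunE /=.
by case: {-}_ / boolP => [uC'|/negP//];
congr (z (exist _ u _)); exact: bool_irrelevance.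
Qed.

(** Turns the filter in [sum_out] into an equality of restrictions. *)
Lemma agree_setD B C (x y : fasg X) :
  [forall u : {v | v \in C}, (val u \notin B) ==> (res C y u == x (val u))] =
  (res (C :\: B) y == res (C :\: B) x).
Proof.
apply/forallP/resP => [e u|e u].
  rewrite inE => /andP[uB uC].
  by have /implyP/(_ uB)/eqP := e (exist _ u uC); rewrite ffunE.
by apply/implyP => uB; rewrite ffunE e // inE uB (valP u).
Qed.

Definition indep (A : Type) D (F : fasg X -> A) : Prop :=
  forall x y, {in ~: D, forall u, x u = y u} -> F x = F y.

Lemma indepS (A : Type) D D' (F : fasg X -> A) :
  D \subset D' -> indep D' F -> indep D F.
Proof.
move=> sDD' iF x y exy; apply: iF => u; rewrite inE => uD'; apply: exy.
by rewrite inE; apply: contra uD'; apply: (subsetP sDD').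
Qed.

End Assignments.

(** * Averaging over one coordinate *)

Section Averaging.
Variables (R : realType) (V : finType) (X : V -> finType).
Hypothesis X0 : forall v, (0 < #|X v|)%N.
Implicit Types (D : {set V}) (F H g : fasg X -> R) (q : V -> fasg X -> R).

(** Exchanging [a] with the coordinate of [x] at [v] is an involution on pairs; reindexing by it
    turns the summand into [F x], free of [a]. *)
Lemma sum_upd v F :
  \sum_x \sum_(a : X v) F (upd x a) = #|X v|%:R * \sum_x F x.
Proof.
rewrite pair_bigA /=.
pose h (p : fasg X * X v) := (upd p.1 p.2, p.1 v).
have hK : involutive h by case=> x a; rewrite /h /= updK upd_in.
rewrite (reindex_inj (inv_inj hK)) /=.
rewrite -(pair_bigA _ (fun x a => F (upd (upd x a) (x v)))) /= mulr_sumr.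
apply: eq_bigr => x _.
under eq_bigr do rewrite updK.
by rewrite sumr_const mulr_natl.
Qed.

(** Once both sides are multiplied by [#|X v|], [sum_upd] produces an inner sum over the value at
    [v], in which [H] is constant and [g] sums to 1. *)
Lemma sum_normalized v H g : indep [set v] H ->
    (forall x, \sum_(a : X v) g (upd x a) = 1) ->
  \sum_x H x * g x = \sum_x H x * #|X v|%:R^-1.
Proof.
move=> iH g1; have nz : #|X v|%:R != 0 :> R by rewrite pnatr_eq0 -lt0n.
apply: (mulfI nz); rewrite -sum_upd mulr_sumr; apply: eq_bigr => x _.
rewrite mulrCA divff // mulr1 -[RHS]mulr1 -(g1 x) mulr_sumr.
apply: eq_bigr => a _; congr (_ * _); apply: iH => u.
by rewrite !inE eq_sym => uv; rewrite upd_out.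
Qed.

End Averaging.

(** * Products of normalized kernels on an acyclic digraph *)

Section Kernels.
Variables (R : realType) (V : finType) (G : influence_diagram V).
Variable X : V -> finType.
Hypothesis X0 : forall v, (0 < #|X v|)%N.
Implicit Types (D : {set V}) (F : fasg X -> R).

Definition kernel_system (q : V -> fasg X -> R) : Prop :=
  (forall v, indep (~: family G v) (q v)) /\
  (forall v x, \sum_(a : X v) q v (upd x a) = 1).

Definition descendant_closed D : Prop :=
  forall u w, u \in D -> arc G u w -> w \in D.

(** A vertex of [D] with the most descendants works: by acyclicity, a parent of it in [D] would have
    strictly more. *)
Lemma source_exists D : D != set0 ->
  exists2 u, u \in D & forall t, t \in D -> ~~ arc G t u.
Proof.
case/set0Pn => u0 u0D.
have [u uD umax] := arg_maxnP (fun u => #|[set w | connect (arc G) u w]|) u0D.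
exists u => // t tD; apply/negP => tu; have := umax t tD.
rewrite /= leqNgt => /negP[]; apply: proper_card; apply/properP; split.
  apply/subsetP => w; rewrite !inE; apply: connect_trans; exact: connect1.
exists t; first by rewrite inE.
by rewrite inE; apply: arc_acyclic.
Qed.

(** Induction on [#|D|], a source [u] of [D] being treated last. By then the other kernels in [D]
    are uniform, and neither [F] nor the kernels outside the descendant-closed [D] see the
    coordinate at [u]. *)
Lemma eliminate_descendants q D F : kernel_system q ->
    descendant_closed D -> indep D F ->
  \sum_x F x * \prod_v q v x =
  \sum_x F x * \prod_v (if v \in D then #|X v|%:R^-1 else q v x).
Proof.
move=> [qfam q1]; have [n] := ubnP #|D|; elim: n D F => // n IH D F leD dD iF.
have [->|/source_exists[u uD usrc]] := eqVneq D set0.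
  by apply: eq_bigr => x _; under [in RHS]eq_bigr do rewrite in_set0.
have sDu : D :\ u \subset D by rewrite subD1set.
rewrite (IH (D :\ u)); first last.
- exact: indepS iF.
(* [D :\ u] stays closed because no arc from [D] ends in the source [u]. *)
- move=> s w; rewrite !inE => /andP[su sD] sw; rewrite (dD s) // andbT.
  by apply: contraTneq sw => ->; apply: usrc.
- by move: leD; rewrite (cardsD1 u D) uD ltnS.
pose H x := F x * \prod_(v | v != u)
  (if v \in D then #|X v|%:R^-1 else q v x).
transitivity (\sum_x H x * q u x); last transitivity (\sum_x H x * #|X u|%:R^-1).
- apply: eq_bigr => x _; rewrite (bigD1 u) //= !inE eqxx /= -mulrA.
  congr (_ * _); rewrite mulrC; congr (_ * _); apply: eq_bigr => v vu.
  by rewrite !inE vu.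
- apply: sum_normalized => // x y exy; congr (_ * _).
    by apply: iF => w; rewrite inE => wD; apply: exy; rewrite !inE;
       apply: contraNneq wD => ->.
  apply: eq_bigr => v vu; case: ifPn => // vD; apply: qfam => w.
  rewrite setCK => wv; apply: exy; rewrite !inE.
  move: wv; rewrite !inE => /orP[/eqP->//|wv].
  by apply: contraNneq vD => wu; apply: dD uD _; rewrite -wu.
- apply: eq_bigr => x _; rewrite /H -mulrA; congr (_ * _).
  by rewrite [RHS](bigD1 u) //= uD mulrC.
Qed.

(** Both sides reduce to the same sum, with uniform kernels on [D]. *)
Lemma swap_kernels q q' D F : kernel_system q -> kernel_system q' ->
    (forall v, v \notin D -> q v = q' v) ->
    descendant_closed D -> indep D F ->
  \sum_x F x * \prod_v q v x = \sum_x F x * \prod_v q' v x.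
Proof.
move=> kq kq' eqq' dD iF.
rewrite (eliminate_descendants kq dD iF) (eliminate_descendants kq' dD iF).
apply: eq_bigr => x _; congr (_ * _); apply: eq_bigr => v _.
by case: ifPn => // /eqq'->.
Qed.

Lemma card_fasg : #|fasg X| = (\prod_v #|X v|)%N.
Proof. by rewrite card_dep_ffun foldrE big_map big_enum. Qed.

Lemma sum_kernels q : kernel_system q -> \sum_x \prod_v q v x = 1.
Proof.
move=> kq; have := eliminate_descendants (D := setT) (F := fun=> 1) kq.
rewrite (eq_bigr _ (fun x _ => mul1r _)) => ->; first last.
- by [].
- by move=> u w _ _; rewrite inE.
under eq_bigr do (rewrite mul1r; under eq_bigr do rewrite inE).
rewrite sumr_const card_fasg -mulr_natl natr_prod -big_split /= big1 // => v _.
by rewrite divff // pnatr_eq0 -lt0n.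
Qed.

(* Given that the coordinates in C are those of x, the coordinate at v has the
   law q v: the kernel at v may be replaced by a point mass, since only v and
   its descendants notice. *)
Lemma local_markov q v (C : {set V}) x : kernel_system q ->
    family G v \subset C -> (forall w, w \in C :\ v -> ~~ connect (arc G) v w) ->
  \sum_(y | res C y == res C x) \prod_w q w y =
  q v x * \sum_(y | res (C :\ v) y == res (C :\ v) x) \prod_w q w y.
Proof.
move=> kq fC ndC; have [qfam q1] := kq.
have vC : v \in C by apply: (subsetP fC); rewrite !inE eqxx.
pose D := [set w | connect (arc G) v w].
pose q' w (y : fasg X) : R := if w == v then (y v == x v)%:R else q w y.
have kq' : kernel_system q'.
  split=> w; rewrite /q'.
    move=> y z eyz; case: eqP => [wv|_]; last exact: qfam.
    by rewrite eyz // setCK wv !inE eqxx.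
  move=> y; case: eqP => [->|_]; last exact: q1.
  rewrite (bigD1 (x v)) //= upd_in eqxx big1 ?addr0 // => a.
  by rewrite upd_in => /negPf->.
rewrite big_mkcond [X in _ * X]big_mkcond /=.
pose F (y : fasg X) : R := (res (C :\ v) y == res (C :\ v) x)%:R.
have -> : \sum_y (if res (C :\ v) y == res (C :\ v) x then \prod_w q w y else 0)
    = \sum_y F y * \prod_w q' w y.
  (* [q] and [q'] differ only at [v], and the indicator [F] ignores the descendants of [v] since
     [C :\ v] contains none. *)
  rewrite -(@swap_kernels q q' D) //.
  - by apply: eq_bigr => y _; rewrite /F; case: ifP; rewrite ?mul1r ?mul0r.
  - by move=> w; rewrite inE /q'; case: eqP => // ->; rewrite connect0.
  - move=> s w; rewrite !inE => vs sw; exact: connect_trans vs (connect1 sw).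
  - move=> y z eyz; rewrite /F; congr ((_ == _)%:R); apply/eqP/resP => w wC.
    by apply: eyz; rewrite !inE ndC.
rewrite mulr_sumr; apply: eq_bigr => y _; rewrite /F.
have -> : (res C y == res C x) = (res (C :\ v) y == res (C :\ v) x) && (y v == x v).
  apply/idP/andP => [e|[/resP e /eqP ev]].
    by split; [apply: eq_resS e; apply: subD1set | apply/eqP; move/resP: e; apply].
  by apply/resP => w wC; have [->//|wv] := eqVneq w v; apply: e; rewrite !inE wv.
have [/= e|/= _] := boolP (res _ _ == _); last by rewrite mul0r mulr0.
rewrite mul1r [in LHS](bigD1 v) //= [in RHS](bigD1 v) //= {1}/q' eqxx.
have [ev|_] := eqVneq (y v) (x v); last by rewrite mul0r mulr0.
rewrite mul1r; congr (_ * _); last by apply: eq_bigr => w /negPf; rewrite /q' => ->.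
(* All of [family G v] lies in [C], where [y] agrees with [x]. *)
apply: qfam => w; rewrite setCK => /(subsetP fC) wC.
have [->//|wv] := eqVneq w v; move/resP: e; apply; by rewrite !inE wv.
Qed.

End Kernels.

(** * Probabilities under a policy *)

Section Policies.
Variables (R : realType) (V : finType) (G : influence_diagram V).
Variable rho : parametrization R G.
Notation X := (dom rho).
Implicit Types (delta : rules rho) (x y : fasg X) (B C D : {set V}).

Definition local_kernel delta v x : R :=
  if v \in decisions G then delta v (res (parents G v) x) (x v)
  else kern rho (res (parents G v) x) (x v).

Lemma fasg_inhabited : exists x0 : fasg X, True.
Proof.
have h v : exists a : X v, true.
  by have /card_gt0P[a _] := dom_nonempty rho v; exists a.
by exists [ffun v => xchoose (h v)].
Qed.

Lemma joint_local_kernel delta x : joint delta x = \prod_v local_kernel delta v x.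
Proof.
rewrite (bigID (mem (decisions G))) /= mulrC /joint; congr (_ * _).
  apply: eq_big => [v|v]; first by rewrite inE.
  by rewrite inE /local_kernel => /negPf->.
by apply: eq_bigr => v vd; rewrite /local_kernel vd.
Qed.

Lemma local_kernel_distr delta v (y : asg X (parents G v)) : is_policy delta ->
  is_distr (fun a : X v => if v \in decisions G then delta v y a
                           else kern rho y a).
Proof.
move=> pd; case: (boolP (v \in decisions G)) => vd; first exact: pd.
by apply: kern_distr; rewrite /nondecisions inE.
Qed.

Lemma kernel_system_policy delta : is_policy delta ->
  kernel_system G (local_kernel delta).
Proof.
move=> pd; split=> [v x y|v x]; last first.
  have [_ <-] := local_kernel_distr (res (parents G v) x) pd.
  apply: eq_bigr => a _; rewrite /local_kernel upd_in.
  have -> // : res (parents G v) (upd x a) = res (parents G v) x.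
  apply/eqP/resP => w; rewrite inE => wv; rewrite upd_out //.
  by apply: contraTneq wv => <-; apply/negP => vv;
     have := arc_acyclic vv; rewrite connect0.
rewrite setCK => exy; rewrite /local_kernel exy ?inE ?eqxx //.
have -> // : res (parents G v) x = res (parents G v) y.
by apply/eqP/resP => w wv; apply: exy; rewrite inE wv orbT.
Qed.

Lemma local_kernel_ge0 delta v x : is_policy delta -> 0 <= local_kernel delta v x.
Proof.
by move=> /(local_kernel_distr (res (parents G v) x))[/(_ (x v)) + _].
Qed.

Lemma joint_ge0 delta x : is_policy delta -> 0 <= joint delta x.
Proof.
by move=> pd; rewrite joint_local_kernel;
apply: prodr_ge0 => v _; apply: local_kernel_ge0.
Qed.

Lemma joint_sum1 delta : is_policy delta -> \sum_x joint delta x = 1.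
Proof.
move=> /kernel_system_policy kd; under eq_bigr do rewrite joint_local_kernel.
by apply: sum_kernels kd; apply: dom_nonempty.
Qed.

Lemma Pr_ge0 delta C (z : asg X C) : is_policy delta -> 0 <= Pr delta z.
Proof. by move=> pd; apply: sumr_ge0 => x _; apply: joint_ge0. Qed.

Lemma Pr_sum1 delta C : is_policy delta -> \sum_(z : asg X C) Pr delta z = 1.
Proof.
by move=> pd; rewrite -(joint_sum1 pd) (partition_big (res C) xpredT).
Qed.

Lemma Pr_le delta B C x : is_policy delta -> B \subset C ->
  Pr delta (res C x) <= Pr delta (res B x).
Proof.
move=> pd sBC; rewrite /Pr big_mkcond [leRHS]big_mkcond /=.
apply: ler_sum => y _; case: ifP => [/(eq_resS sBC)->//|_].
by case: ifP => // _; apply: joint_ge0.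
Qed.

Lemma Pr_markov delta v C x : is_policy delta -> family G v \subset C ->
    (forall w, w \in C :\ v -> ~~ connect (arc G) v w) ->
  Pr delta (res C x) = local_kernel delta v x * Pr delta (res (C :\ v) x).
Proof.
move=> /kernel_system_policy kd fC ndC; rewrite /Pr.
under eq_bigr do rewrite joint_local_kernel.
rewrite (local_markov (@dom_nonempty _ _ _ rho) x kd fC ndC).
by under [in RHS]eq_bigr do rewrite joint_local_kernel.
Qed.

(** Full assignments are grouped by their restriction to [C]. *)
Lemma sum_out_Pr delta B C x :
  sum_out (Pr delta (C := C)) B x = Pr delta (res (C :\: B) x).
Proof.
rewrite /sum_out /Pr
  [RHS](partition_big (res C) (fun z : asg X C =>
    [forall u, (val u \notin B) ==> (z u == x (val u))])) /=.
  apply: eq_bigr => z zx; apply: eq_bigl => y.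
  by case: eqP => [e|]; rewrite ?andbF // -agree_setD e zx.
by move=> y; rewrite -agree_setD.
Qed.

Lemma cPr_set0 delta C x : 0 < Pr delta (res (C :\: set0) x) ->
  cPr delta set0 (C :\: set0) x = 1.
Proof. by move=> p0; rewrite /cPr set0U divff // gt_eqF. Qed.

End Policies.

(** * Rooted junction trees with one offspring per node *)

Section RootedTree.
Variables (V : finType) (G : influence_diagram V) (T : rooted_junction_tree G).
Hypothesis hT : singleton_offspring T.
Local Notation t := (tarc T).
Implicit Types (u v w : V) (C D : {set V}).

Lemma clique_node v : clique T v \in nodes T.
Proof. by case: (rjt_clique T v). Qed.

Lemma clique_inj : injective (clique T).
Proof.
move=> u v uv; have /setP/(_ u) := hT.1 v.
by rewrite !inE uv eqxx => /esym/eqP.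
Qed.

(** A directed cycle appended to the walk from the root to [C] would give a second such walk. *)
Lemma tree_acyclic C p : C \in nodes T -> path t C p -> last C p = C -> p = [::].
Proof.
move=> CN pp lp; have [_ _ /(_ C CN)[q [[pq lq] uq]]] := rjt_rooted T.
have := uq (q ++ p); rewrite cat_path last_cat lq pq pp lp => /(_ (conj isT erefl)).
move/(congr1 size)/eqP; rewrite size_cat -{1}[size q]addn0 eqn_add2l.
by case: p {pp lp}.
Qed.

Lemma tree_connect_anti C D : C \in nodes T -> connect t C D -> connect t D C ->
  C = D.
Proof.
move=> CN /connectP[p pp ->] /connectP[q pq e].
have := @tree_acyclic C (p ++ q) CN.
by rewrite cat_path last_cat pp pq -e => /(_ isT erefl); case: p {pp pq e}.
Qed.

Lemma tree_parent_unique C C' D : t C D -> t C' D -> C = C'.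
Proof.
move=> tC tC'; have [_ sub ex] := rjt_rooted T.
have [/andP[CN DN] /andP[C'N _]] := (sub _ _ tC, sub _ _ tC').
have [q [[pq lq] _]] := ex C CN; have [q' [[pq' lq'] _]] := ex C' C'N.
have [r [_ ur]] := ex D DN.
have := ur (rcons q D); have := ur (rcons q' D).
rewrite !rcons_path !last_rcons pq pq' lq lq' tC tC'.
move=> /(_ (conj isT erefl)) -> /(_ (conj isT erefl)) /eqP.
by rewrite eqseq_rcons => /andP[/eqP qq' _]; rewrite -lq -lq' qq'.
Qed.

Lemma clique_connect w v : w \in clique T v -> connect t (clique T w) (clique T v).
Proof.
move=> wv; have [_ _ /(_ _ (clique_node v) wv)] := rjt_clique T w.
by apply: connect_sub => C D /and3P[_ _ tCD]; apply: connect1.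
Qed.

(** A parent of [w] lies in [clique T w], hence has its root clique above it. *)
Lemma clique_connect_arc u v : connect (arc G) u v ->
  connect t (clique T u) (clique T v).
Proof.
move=> /connectP[p + ->]; elim: p u => [|w p IH] u /=; first by rewrite connect0.
case/andP=> uw /IH; apply: connect_trans; apply: clique_connect.
by apply: (subsetP (rjt_family T w)); rewrite !inE uw orbT.
Qed.

(** The root clique of [w] is above that of [v]; for a descendant it would also be below, forcing
    [w = v]. *)
Lemma cliquem_not_descendant v w : w \in clique T v :\ v ->
  ~~ connect (arc G) v w.
Proof.
rewrite !inE => /andP[wv /clique_connect cwv]; apply: contra wv => cvw.
apply/eqP/clique_inj/tree_connect_anti => //; first exact: clique_node.
exact: clique_connect_arc.
Qed.

Lemma notin_parent_clique C v : t C (clique T v) -> v \notin C.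
Proof.
move=> tC; apply/negP => vC; have [_ sub _] := rjt_rooted T.
have /andP[CN _] := sub _ _ tC.
have [_ _ /(_ C CN vC)] := rjt_clique T v.
move=> /(connect_sub (e' := t)) c.
have cvC : connect t (clique T v) C.
  by apply: c => A B /and3P[_ _ tAB]; apply: connect1.
have e := tree_connect_anti CN (connect1 tC) cvC.
have := @tree_acyclic C [:: C] CN; rewrite /= {2}e tC => /(_ isT erefl).
by [].
Qed.

(** For [w] other than [v], the path from [clique T w] to [clique T v] is nonempty and stays in
    nodes containing [w]; its last node but one is the unique parent [C]. *)
Lemma cliquem_sub_parent C v : t C (clique T v) -> clique T v :\ v \subset C.
Proof.
move=> tC; apply/subsetP => w; rewrite !inE => /andP[wv wCv].
have [_ _ /(_ _ (clique_node v) wCv)/connectP[p]] := rjt_clique T w.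
elim/last_ind: p => [_ /= /clique_inj vw|p D _]; first by rewrite vw eqxx in wv.
rewrite rcons_path last_rcons /= => /andP[_ /and3P[wl _ tl]] eD.
by rewrite -eD in tl; rewrite (tree_parent_unique tC tl).
Qed.

Lemma clique_setD_parent C v : t C (clique T v) -> clique T v :\: C = [set v].
Proof.
move=> tC; apply/setP => w; rewrite !inE.
have [->|wv] := eqVneq w v; first by rewrite notin_parent_clique ?mem_clique.
apply/negP => /andP[wC wCv]; case/negP: wC.
by apply: (subsetP (cliquem_sub_parent tC)); rewrite !inE wv.
Qed.

Lemma parent_setD C v : t C (clique T v) ->
  C :\: (C :\: clique T v) = clique T v :\ v.
Proof.
move=> tC; apply/setP => w; rewrite !inE negb_and negbK.
have [->|wv /=] := eqVneq w v;
  first by rewrite (negPf (notin_parent_clique tC)) andbF.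
have [wCv|wCv] := boolP (w \in clique T v); last by case: (w \in C).
by rewrite orTb /= (subsetP (cliquem_sub_parent tC)) // !inE wv.
Qed.

Lemma root_clique v : clique T v = troot T -> clique T v :\ v = set0.
Proof.
move=> ev; apply/eqP; rewrite -subset0; apply/subsetP => w.
rewrite !inE => /andP[/eqP wv /clique_connect cwv]; case: wv.
apply/clique_inj/tree_connect_anti => //; first exact: clique_node.
have [_ _ /(_ _ (clique_node w))[q [[pq lq] _]]] := rjt_rooted T.
by rewrite ev; apply/connectP; exists q.
Qed.

End RootedTree.

(** * Feasible solutions and moments *)

Section Moments.
Variables (R : realType) (V : finType) (G : influence_diagram V).
Variables (rho : parametrization R G) (T : rooted_junction_tree G).
Hypothesis hT : singleton_offspring T.
Notation X := (dom rho).
Implicit Types (mu : mvector rho T) (delta : rules rho) (x : fasg X).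

Lemma Pr_clique delta v x : is_policy delta ->
  Pr delta (res (clique T v) x) =
  Pr delta (res (cliquem T v) x) * local_kernel delta v x.
Proof.
move=> pd; rewrite mulrC; apply: Pr_markov => //; first exact: rjt_family.
by move=> w; apply: cliquem_not_descendant.
Qed.

(** Induction on the walk from the root to [clique T v]. Both sides have the factor [local_kernel],
    so only the marginals on [cliquem T v] have to be compared. *)
Lemma moments_of_kernels mu delta : is_policy delta -> in_L mu ->
    (forall v x, muC mu (res (clique T v) x) =
                 muc mu (res (cliquem T v) x) * local_kernel delta v x) ->
  is_moments_of mu delta.
Proof.
move=> pd [distr adj mc] muk.
have [x0 _] := fasg_inhabited rho.
suff main p v : path (tarc T) (troot T) p -> last (troot T) p = clique T v ->
    forall z, muC mu (v := v) z = Pr delta z.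
  move=> v; have [_ _ /(_ _ (clique_node T v))[p [[pp lp] _]]] := rjt_rooted T.
  exact: main lp.
elim/last_ind: p v => [|p C IH] v.
  (* At the root [cliquem T v] is empty, so both marginals are total masses, equal to 1. *)
  move=> _ /esym/= /(root_clique hT) v0 z; have [x <-] := res_surj x0 z.
  rewrite muk Pr_clique //; congr (_ * _).
  rewrite mc -[RHS](sum_out_Pr _ [set v]) /sum_out.
  have all_z (z' : asg X (clique T v)) :
      [forall u, (val u \notin [set v]) ==> (z' u == x (val u))].
    apply/forallP => -[u uC]; apply/implyP; rewrite inE /= => uv.
    by have /setP/(_ u) := v0; rewrite !inE uv uC.
  rewrite (eq_bigl _ _ all_z) [RHS](eq_bigl _ _ all_z) Pr_sum1 //.
  by have [] := distr v.
rewrite rcons_path last_rcons => /andP[pp tC] eC z.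
have [x <-] := res_surj x0 z; rewrite muk Pr_clique //; congr (_ * _).
rewrite eC in tC; have [_ sub _] := rjt_rooted T; have /andP[CN _] := sub _ _ tC.
(* The parent node is some [clique T u], and adjacency turns the marginal on [cliquem T v] into one
   of [muC] at [u], known by induction. *)
move: CN; rewrite hT.2 => /imsetP[u _ eu].
rewrite eu in tC; rewrite mc -(clique_setD_parent hT tC) adj ?tC ?orbT //.
rewrite /cliquem -(parent_setD hT tC) -sum_out_Pr.
by apply: eq_bigr => z' _; apply: IH.
Qed.

(* A deterministic policy turns the constraints of Q^b into the equality
   mu_(C_v) = mu_(C_v minus v) * delta_v, whatever the value of the bound. *)
Lemma feasible_moments b mu delta :
  MILP_feasible b mu delta -> is_moments_of mu delta.
Proof.
move=> [[[inL kern_eq] _] [pd dd] [_ _ inQ]].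
have [x0 _] := fasg_inhabited rho.
apply: moments_of_kernels => // v x; rewrite /local_kernel.
case: ifPn => vd; last by apply: kern_eq; rewrite /nondecisions inE.
have [ge0 _] : is_distr (muC mu (v := v)) by have [+ _ _] := inL; apply.
have := inQ v vd x; move: (dd v vd (res (parents G v) x) (x v)) => /=.
(* At value 1 the first and third constraints squeeze [muC]; at value 0 the second one and
   nonnegativity do. *)
case=> ->; last first.
  by rewrite subrr mul0r addr0 mulr1 => -[h1 _ h2]; apply/eqP; rewrite eq_le h1 h2.
by rewrite mul0r mulr0 => -[_ h _]; apply/eqP; rewrite eq_le h ge0.
Qed.

Lemma objective_expected_utility mu delta : is_moments_of mu delta ->
  MILP_objective mu = expected_utility delta.
Proof.
move=> mom; rewrite /MILP_objective /expected_utility.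
under [RHS]eq_bigr do rewrite mulr_sumr.
rewrite [RHS]exchange_big /=; apply: eq_bigr => v _.
rewrite [RHS](partition_big (fun x : fasg X => x v) xpredT) //=.
apply: eq_bigr => a _; rewrite /mu_at mulr_sumr.
rewrite [RHS](partition_big (res (clique T v))
  (fun z : asg X (clique T v) => z (exist _ v (mem_clique T v)) == a)) /=;
  last first.
  by move=> x; rewrite ffunE.
apply: eq_bigr => z za; rewrite mom /Pr mulr_sumr.
apply: eq_big => [x|x /eqP zx].
  by case: eqP => [zx|]; rewrite ?andbF // -zx ffunE in za *; rewrite za.
by move: za; rewrite -zx ffunE => /eqP<-; rewrite mulrC.
Qed.

Definition moment_vector delta : mvector rho T :=
  MVector (fun v (z : asg X (clique T v)) => Pr delta z)
          (fun v (z : asg X (cliquem T v)) => Pr delta z).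

Lemma perp_sub C : perp R G C \subset C.
Proof.
rewrite /perp; case: pickP => [D /asboolP[]//|_]; exact: sub0set.
Qed.

(** For the default value [set0] of [perp], both conditional probabilities are 1. *)
Lemma perp_independent C : policy_independent R G C (perp R G C).
Proof.
rewrite /perp; case: pickP => [D /asboolP[]//|_] /= rho' d d' _ _ x p p'.
by rewrite !cPr_set0.
Qed.

(** If the conditioning event is null, both sides vanish. Otherwise [perp_kern] is computed under
    some chosen policy, and policy independence carries it over to [delta]. *)
Lemma Pr_perp delta C x : is_policy delta ->
  Pr delta (res C x) =
  perp_kern C x * Pr delta (res (C :\: perp R G C) x).
Proof.
move=> pd; have [p0|] := ltP 0 (Pr delta (res (C :\: perp R G C) x)); last first.
  move=> le0; have e0 : Pr delta (res (C :\: perp R G C) x) = 0.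
    by apply/eqP; rewrite eq_le le0 Pr_ge0.
  rewrite e0 mulr0; apply/eqP; rewrite eq_le Pr_ge0 // andbT -e0.
  by apply: Pr_le => //; apply: subsetDl.
rewrite /perp_kern; case: pselect => [ex|[]]; last by exists delta.
case: (cid ex) => d [pd' p0'] /=.
rewrite (perp_independent pd' pd p0' p0) /cPr divfK ?gt_eqF //.
have e : perp R G C :|: C :\: perp R G C = C.
  by rewrite -[RHS](setID C (perp R G C)) (setIidPr (perp_sub C)).
by rewrite [in RHS]e.
Qed.

Lemma in_L_moment_vector delta : is_policy delta -> in_L (moment_vector delta).
Proof.
move=> pd; split=> [v|u v _ x|v x] /=.
- by split=> [z|]; [apply: Pr_ge0|apply: Pr_sum1].
- rewrite !sum_out_Pr.
  have -> // : clique T u :\: (clique T u :\: clique T v) =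
    clique T v :\: (clique T v :\: clique T u).
  by rewrite !setDDr !setDv !set0U setIC.
- by rewrite sum_out_Pr.
Qed.

Lemma feasible_moment_vector (b : bounds rho T) delta :
    admissible_bound b -> is_deterministic_policy delta ->
  MILP_feasible b (moment_vector delta) delta.
Proof.
move=> hb [pd dd]; have inL := in_L_moment_vector pd.
split=> //; first split; first split=> //.
- move=> v vs x /=; rewrite Pr_clique // /local_kernel.
  by move: vs; rewrite /nondecisions inE => /negPf->.
- by move=> v vd x /=; rewrite sum_out_Pr; apply: Pr_perp.
- split=> // v vd x /=; rewrite Pr_clique // /local_kernel vd.
  have := hb delta pd v vd (res (cliquem T v) x).
  have := Pr_ge0 (res (cliquem T v) x) pd.
  (* The bound enters at value 0 through the first constraint and at value 1 through the second;
     both then say that the probability is at most [b]. *)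
  case: (dd v vd (res (parents G v) x) (x v)) => -> P0 Pb.
    by rewrite mulr0 mul0r sub0r mulN1r subr_le0 P0 Pb.
  by rewrite subrr mul0r addr0 mulr1 mul1r.
Qed.

End Moments.

(** * Replacing policies by deterministic ones *)

Section Determinization.
Variables (R : realType) (V : finType) (G : influence_diagram V).
Variable rho : parametrization R G.
Notation X := (dom rho).
Implicit Types (delta : rules rho) (x : fasg X).
Local Notation info u z := (Tagged (fun v => asg X (parents G v)) (i := u) z).

(* The values c and a lie in different types unless v = v0, whence the
   comparison of tagged values. *)
Definition play delta v0 (y0 : asg X (parents G v0)) (a : X v0) : rules rho :=
  fun v y c => if info v y == info v0 y0 then (Tagged X c == Tagged X a)%:R
               else delta v y c.

Lemma play_policy delta v0 (y0 : asg X (parents G v0)) (a : X v0) :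
  is_policy delta -> is_policy (play delta y0 a).
Proof.
move=> pd v vd y; rewrite /play; case: eqP => [e|_]; last exact: pd.
have ev : v = v0 := congr1 tag e; subst v0.
split=> [c|]; first exact: ler0n.
rewrite (bigD1 a) //= eqxx big1 ?addr0 // => c ca.
by rewrite eq_Tagged /= (negPf ca).
Qed.

(** Only the factor at [v0] changes. If [x] restricts to [y0] on the parents, the term [a = x v0]
    alone survives; otherwise all terms agree up to weights of sum 1. *)
Lemma joint_play delta v0 (y0 : asg X (parents G v0)) x : is_policy delta ->
    v0 \in decisions G ->
  joint delta x = \sum_a delta v0 y0 a * joint (play delta y0 a) x.
Proof.
move=> pd v0d; rewrite joint_local_kernel (bigD1 v0) //=.
under [RHS]eq_bigr => a _.
  rewrite joint_local_kernel (bigD1 v0) //=.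
  rewrite (eq_bigr (fun v => local_kernel delta v x)); last first.
    move=> v vv0; rewrite /local_kernel /play.
    by case: eqP => // /(congr1 tag)/= e; rewrite e eqxx in vv0.
  over.
under [RHS]eq_bigr do rewrite mulrA.
rewrite -mulr_suml; congr (_ * _); rewrite /local_kernel v0d /play.
rewrite eq_Tagged /=; have [->|_] := eqVneq (res (parents G v0) x) y0.
  rewrite (bigD1 (x v0)) //= eqxx mulr1 big1 ?addr0 // => a ax.
  by rewrite eq_Tagged /= eq_sym (negPf ax) mulr0.
by rewrite -mulr_suml; case: (pd _ v0d y0) => _ ->; rewrite mul1r.
Qed.

Lemma expected_utility_play delta v0 (y0 : asg X (parents G v0)) :
    is_policy delta -> v0 \in decisions G ->
  exists a, expected_utility delta <= expected_utility (play delta y0 a).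
Proof.
move=> pd v0d; have [x0 _] := fasg_inhabited rho.
have [a _ amax] := arg_maxP (fun a => expected_utility (play delta y0 a))
  (isT : xpredT (x0 v0)).
exists a; have [d0 d1] := pd _ v0d y0.
have -> : expected_utility delta =
    \sum_c delta v0 y0 c * expected_utility (play delta y0 c).
  rewrite /expected_utility; under [RHS]eq_bigr do rewrite mulr_sumr.
  rewrite exchange_big; apply: eq_bigr => x _ /=.
  rewrite (joint_play y0) // mulr_suml; apply: eq_bigr => c _.
  by rewrite mulrA.
rewrite -[leRHS]mul1r -d1 mulr_suml; apply: ler_sum => c _.
by apply: ler_wpM2l => //; apply: amax.
Qed.

Lemma deterministic_dominates delta : is_policy delta ->
  exists2 delta' : rules rho, is_deterministic_policy delta' &
    expected_utility delta <= expected_utility delta'.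
Proof.
move=> pd.
(* Pairs of a vertex and a parent assignment are treated one by one, by induction on their list. *)
suff [d [pd' dd le]] : exists d : rules rho, [/\ is_policy d,
    forall v y a, v \in decisions G ->
      info v y \in enum {: {v & asg X (parents G v)}} ->
      d v y a = 0 \/ d v y a = 1 &
    expected_utility delta <= expected_utility d].
  exists d => //; split=> // v vd y a; apply: dd => //; exact: mem_enum.
elim: (enum _) => [|[v0 y0] s [d [pd' dd le]]]; first by exists delta; split.
have [v0d|v0d] := boolP (v0 \in decisions G); last first.
  exists d; split=> // v y a vd; rewrite inE => /orP[/eqP/(congr1 tag)/= e|].
    by rewrite e (negPf v0d) in vd.
  exact: dd.
have [a0 le0] := expected_utility_play y0 pd' v0d.
exists (play d y0 a0); split; last exact: le_trans le le0.
  exact: play_policy.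
(* The new play alters one distribution only, so those made deterministic earlier remain so. *)
move=> v y a vd; rewrite inE /play; case: eqP => /= [_ _|_]; last exact: dd.
by case: (_ == _); [right|left].
Qed.

End Determinization.

Theorem proposition4 (R : realType) (V : finType) (G : influence_diagram V)
    (rho : parametrization R G) (T : rooted_junction_tree G)
    (hT : singleton_offspring T)
    (b : bounds rho T) (hb : admissible_bound b) :
  (forall (mu : mvector rho T) (delta : rules rho),
     MILP_feasible b mu delta -> is_moments_of mu delta) /\
  (forall (mu : mvector rho T) (delta : rules rho),
     MILP_feasible b mu delta ->
     (MILP_optimal b mu delta <-> MEU_optimal delta)).
Proof.
have objE mu delta : MILP_feasible b mu delta ->
    MILP_objective mu = expected_utility delta.
  by move=> /(feasible_moments hT)/objective_expected_utility.
split=> [|mu delta fd]; first exact: feasible_moments.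
have [_ [pd _] _] := fd; split=> -[_ opt]; split=> //.
  (* A competing policy is dominated by a deterministic one, whose moment vector is feasible. *)
  move=> delta' pd'; have [d dd le] := deterministic_dominates pd'.
  have fd' := feasible_moment_vector hT hb dd.
  by rewrite (le_trans le) // -(objE _ _ fd') -(objE _ _ fd); apply: opt fd'.
by move=> mu' delta' fd'; rewrite (objE _ _ fd) (objE _ _ fd'); apply: opt;
   have [_ [? _] _] := fd'.
Qed.
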